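(* $( *G, <) \mapsto (\mathbb{R}/\overline{\mathbb{R}}, \leq)$. That is: if $f, g \in *G$ satisfy $f < g$ in $*G$, then after transfer to $\overline{\mathbb{R}}$ the realizations of $f$ and $g$ satisfy $\leq$.
   Context: $*G$ denotes the gossamer number system: numbers built from the finite integers together with infinite integers (integers larger in magnitude than every finite integer) in the same way that the reals are built from the integers. It is taken to be a totally ordered field containing the ordered field $\mathbb{R}$ as a subfield and containing infinite numbers. A number in $*G$ is a positive (negative) infinity if it is larger (smaller) than every real number; $\Phi^{-1}$ is the set of all infinities, and $\Phi = \{x \in *G\setminus\{0\}: 1/x \in \Phi^{-1}\}$ is the set of infinitesimals. $a \simeq b$ means $a - b \in \Phi \cup \{0\}$. $\overline{\mathbb{R}} = \mathbb{R} \cup \{\pm\infty\}$ with its usual order. The transfer $*G \mapsto \mathbb{R}/\overline{\mathbb{R}}$ realizes infinitesimals as $0$ and infinities as $\pm\infty$: the realization of a positive (negative) infinity is $+\infty$ ($-\infty$), and the realization of any other element $a$ is its standard part, the unique real $r$ with $a \simeq r$. *)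

(* Defs.v *)
From HB Require Import structures.
From mathcomp Require Import all_boot all_order all_algebra.
From mathcomp Require Import boolp classical_sets reals constructive_ereal.

Set Implicit Arguments.
Unset Strict Implicit.
Unset Printing Implicit Defensive.

Import Order.TTheory GRing.Theory Num.Theory.

Local Open Scope classical_set_scope.
Local Open Scope ring_scope.

(* [iota] is the inclusion of the reals [R] as a subfield of [G]. *)

Definition positive_infinities (R : realType) (G : realFieldType)
    (iota : {rmorphism R -> G}) : set G :=
  [set a | forall r : R, iota r < a].

Definition negative_infinities (R : realType) (G : realFieldType)
    (iota : {rmorphism R -> G}) : set G :=
  [set a | forall r : R, a < iota r].

Definition infinities (R : realType) (G : realFieldType)
    (iota : {rmorphism R -> G}) : set G :=
  positive_infinities iota `|` negative_infinities iota.

Definition infinitesimals (R : realType) (G : realFieldType)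
    (iota : {rmorphism R -> G}) : set G :=
  [set x | x != 0 /\ infinities iota (1 / x)].

Definition infinitely_close (R : realType) (G : realFieldType)
    (iota : {rmorphism R -> G}) (a b : G) : Prop :=
  (infinitesimals iota `|` [set 0]) (a - b).

(* The real infinitely close to [a]; it exists and is unique when [a] is not
   an infinity. The default 0 of [xget] is a junk value for infinite [a]. *)
Definition standard_part (R : realType) (G : realFieldType)
    (iota : {rmorphism R -> G}) (a : G) : R :=
  xget 0 [set r : R | infinitely_close iota a (iota r)].

Definition realization (R : realType) (G : realFieldType)
    (iota : {rmorphism R -> G}) (a : G) : \bar R :=
  if `[< positive_infinities iota a >] then +oo%E
  else if `[< negative_infinities iota a >] then -oo%E
  else (standard_part iota a)%:E.

(* Main.v *)
(* An element [a] between two reals has standard part [sup {r | r <= a}], and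
   [a] is infinitely close to [b] iff [|a - b|] is below every positive real.
   If finite [f < g] had standard parts [s > t], closeness within
   [(s - t) / 2] would put [g] below and [f] above the midpoint of [t], [s]. *)
Require Import Defs.
From HB Require Import structures.
From mathcomp Require Import all_boot all_order all_algebra.
From mathcomp Require Import boolp classical_sets reals constructive_ereal.

Set Implicit Arguments.
Unset Strict Implicit.
Unset Printing Implicit Defensive.

Import Order.TTheory GRing.Theory Num.Theory.

Local Open Scope classical_set_scope.
Local Open Scope ring_scope.

(** The reals are closed under negation, so lying below every real amounts to [- x] exceeding every
    real; conversely the sign of [x] decides which kind of infinity it is. *)
Lemma infinitiesP (R : realType) (G : realFieldType)
    (iota : {rmorphism R -> G}) (x : G) :
  infinities iota x <-> forall r : R, iota r < `|x|.
Proof.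
split=> [[pos|neg] r|big].
- by rewrite (lt_le_trans (pos r)) // ler_norm.
- by rewrite -normrN (lt_le_trans _ (ler_norm _)) // ltrNr -rmorphN neg.
- have [x_ge0|x_lt0] := leP 0 x; [left|right] => r.
    by rewrite -(ger0_norm x_ge0).
  by rewrite -[iota r]opprK ltrNr -rmorphN -(ltr0_norm x_lt0).
Qed.

(** Inversion reverses the order on positive elements and commutes with [iota], so bounds [r] on
    [1 / x] correspond to bounds [r^-1] on [x]. *)
Lemma infinitely_closeP (R : realType) (G : realFieldType)
    (iota : {rmorphism R -> G}) (iota_lt : {mono iota : x y / x < y})
    (a b : G) :
  infinitely_close iota a b <-> forall e : R, 0 < e -> `|a - b| < iota e.
Proof.
have iota_gt0 (e : R) : (0 < iota e) = (0 < e).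
  by rewrite -(rmorph0 iota) iota_lt.
rewrite /infinitely_close; set x := a - b.
split=> [[[x_neq0 /infinitiesP big]|->] e e_gt0|small].
- move: (big e^-1).
  by rewrite div1r normfV fmorphV ltf_pV2 ?posrE ?iota_gt0 ?normr_gt0.
- by rewrite normr0 iota_gt0.
- have [->|x_neq0] := eqVneq x 0; [by right|left; split=> //].
  (* Only a positive [r] is handled through [small] at [r^-1]; otherwise [iota r <= 0 < |1 / x|]. *)
  apply/infinitiesP => r; have [r_gt0|r_le0] := ltP 0 r.
    rewrite div1r normfV -[iota r]invrK ltf_pV2 -?fmorphV ?small //
      ?posrE ?iota_gt0 ?normr_gt0 ?invr_gt0 //.
  apply: (@le_lt_trans _ _ 0); last by rewrite normr_gt0 div1r invr_eq0.
  by rewrite leNgt iota_gt0 -leNgt.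
Qed.

Lemma standard_partP (R : realType) (G : realFieldType)
    (iota : {rmorphism R -> G}) (iota_mono : {mono iota : x y / x <= y})
    (a : G) :
  ~ positive_infinities iota a -> ~ negative_infinities iota a ->
  infinitely_close iota a (iota (standard_part iota a)).
Proof.
have iota_lt := leW_mono iota_mono.
move=> /existsNP[u /negP]; rewrite -leNgt => a_le_u.
move=> /existsNP[l /negP]; rewrite -leNgt => l_le_a.
pose S := [set r : R | iota r <= a].
have S_sup : has_sup S.
  split; first by exists l.
  by exists u => r /= r_le_a; rewrite -iota_mono (le_trans r_le_a).
have close : infinitely_close iota a (iota (sup S)).
  apply/(infinitely_closeP iota_lt) => e e_gt0.
  rewrite ltr_distl -rmorphB -rmorphD; apply/andP; split.
    have [r /= r_le_a sup_lt_r] := sup_adherent e_gt0 S_sup.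
    by rewrite (lt_le_trans _ r_le_a) // iota_lt.
  (* If [a] were at least [iota (sup S + e)], then [sup S + e] would lie in [S], above its
     supremum. *)
  rewrite ltNge; apply/negP => /(sup_upper_bound S_sup).
  by rewrite gerDl leNgt e_gt0.
(* With [sup S] as a witness, [xget] returns a real close to [a] and not its default 0. *)
apply: (@xgetPex _ 0 [set r : R | infinitely_close iota a (iota r)]).
by exists (sup S).
Qed.

Theorem theorem4p6 (R : realType) (G : realFieldType)
    (iota : {rmorphism R -> G})
    (iota_mono : {mono iota : x y / x <= y})
    (G_infinite : infinities iota !=set0)
    (f g : G) (fg : f < g) :
  (realization iota f <= realization iota g)%E.
Proof.
have iota_lt := leW_mono iota_mono.
rewrite /realization.
case: asboolP => [f_pos|f_npos].
  (* Anything above a positive infinity is one too, so both realizations are [+oo]. *)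
  rewrite asboolT // => r; exact: lt_trans (f_pos r) fg.
case: asboolP => [_|f_nneg]; first exact: leNye.
case: asboolP => [_|g_npos]; first exact: leey.
case: asboolP => [g_neg|g_nneg].
  by case: f_nneg => r; apply: lt_trans fg (g_neg r).
rewrite lee_fin leNgt; apply/negP.
set s := standard_part iota f; set t := standard_part iota g => t_lt_s.
have e_gt0 : 0 < (s - t) / 2 by rewrite divr_gt0 ?subr_gt0.
have /(infinitely_closeP iota_lt)/(_ _ e_gt0)
  := standard_partP iota_mono f_npos f_nneg.
have /(infinitely_closeP iota_lt)/(_ _ e_gt0)
  := standard_partP iota_mono g_npos g_nneg.
rewrite -/s -/t !ltr_distl -!rmorphB -!rmorphD => /andP[_ g_lt] /andP[f_gt _].
(* With [e = (s - t) / 2] the chain gives [s - e < t + e], but both sides equal the midpoint. *)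
have := lt_trans (lt_trans f_gt fg) g_lt.
by rewrite iota_lt ltrBlDr -addrA -splitr addrC subrK ltxx.
Qed.
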